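(* Let $\Gamma_0\subset\mathbb{R}^d$ be a $(d-1)$-dimensional Lipschitz shape. The set $\mathcal{H}^{1/2}(\Gamma_0,\mathbb{R}^d)$ and the space $\mathcal{B}^{1/2}(\Gamma_0,\mathbb{R}^d)=\mathcal{H}^{1/2}(\Gamma_0,\mathbb{R}^d)/\!\sim$ carry unique diffeologies such that the inclusion map $$\iota_{\mathcal{H}^{1/2}(\Gamma_0,\mathbb{R}^d)}\colon \mathcal{H}^{1/2}(\Gamma_0,\mathbb{R}^d)\to H^{1/2}(\Gamma_0,\mathbb{R}^d)$$ is an induction and such that the canonical projection $$\pi\colon \mathcal{H}^{1/2}(\Gamma_0,\mathbb{R}^d)\to\mathcal{B}^{1/2}(\Gamma_0,\mathbb{R}^d)$$ is a subduction.
   Context: Lipschitz shapes: a $(d-1)$-dimensional Lipschitz shape is the boundary $\Gamma_0=\partial\mathcal{X}_0$ of a non-empty compact Lipschitz domain $\mathcal{X}_0\subset\mathbb{R}^d$. Here Lipschitz means that for every $x\in\partial\mathcal{X}_0$ there are local coordinates $y_1,\dots,y_d$ centered at $x$, constants $a,b>0$ and a Lipschitz function $\psi$ on the ball of radius $a$ centered at $x$ in the linear subspace with coordinates $\widetilde y=(y_1,\dots,y_{d-1})$, such that: $y_d=\psi(\widetilde y)$ implies $(\widetilde y,y_d)\in\partial\mathcal{X}_0$; $\psi(\widetilde y)<y_d<\psi(\widetilde y)+b$ implies $(\widetilde y,y_d)\in\mathcal{X}_0$; and $\psi(\widetilde y)-b<y_d<\psi(\widetilde y)$ implies $(\widetilde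 y,y_d)\notin\mathcal{X}_0$. The spaces: $H^{1/2}(\Gamma_0,\mathbb{R}^d)$ is the Sobolev–Slobodeckij space, a Banach space; as a (Banach) manifold it is equipped with the diffeology consisting of all parametrizations that are smooth in the classical sense. Define $$\mathcal{H}^{1/2}(\Gamma_0,\mathbb{R}^d):=\{w : w\in H^{1/2}(\Gamma_0,\mathbb{R}^d)\text{ injective, continuous};\ w(\Gamma_0)\text{ Lipschitz shape}\},$$ and for $w_1,w_2\in\mathcal{H}^{1/2}(\Gamma_0,\mathbb{R}^d)$ put $w_1\sim w_2$ if and only if $w_1(\Gamma_0)=w_2(\Gamma_0)$. The space of $(d-1)$-dimensional $H^{1/2}$-shapes is $\mathcal{B}^{1/2}(\Gamma_0,\mathbb{R}^d):=\mathcal{H}^{1/2}(\Gamma_0,\mathbb{R}^d)/\!\sim$, and $\pi$ sends $w$ to its equivalence class. Diffeologies: let $Y$ be a non-empty set. A parametrization in $Y$ is a map $U\to Y$, where $U$ is an open subset of some $\mathbb{R}^n$. A diffeology on $Y$ is a set $D_Y$ of parametrizations in $Y$ such that: (i) every constant parametrization $\mathbb{R}^n\to Y$ is in $D_Y$; (ii) if $P$ is a parametrization in $Y$ such that every point of its domain has an open neighbourhood $V$ with $P|_V\in D_Y$, then $P\in D_Y$; (iii) if $p\colon O\to Y$ is in $D_Y$ with $O\subset\mathbb{R}^n$ open, and $q\colon O'\to O$ is smooth in the usual sense with $O'\subset\mathbb{R}^m$ open, then $p\circ q\in D_Y$. A map $f\colon X\to Y$ between sets with diffeologies $D_X$, $D_Y$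 is smooth if $f\circ p\in D_Y$ for all $p\in D_X$. Pullback and induction: for a map $f\colon X\to Y$ and a diffeology $D_Y$ on $Y$, the pullback $f^\ast(D_Y)$ is the coarsest diffeology on $X$ making $f$ smooth; a parametrization $p$ in $X$ lies in $f^\ast(D_Y)$ if and only if $f\circ p\in D_Y$. A map $f\colon (X,D_X)\to(Y,D_Y)$ is an induction if $f$ is injective and $f^\ast(D_Y)=D_X$. Pushforward and subduction: for a map $f\colon X\to Y$ and a diffeology $D_X$ on $X$, the pushforward $f_\ast(D_X)$ is the finest diffeology on $Y$ making $f$ smooth; a parametrization $p\colon U\to Y$ lies in $f_\ast(D_X)$ if and only if every point of $U$ has an open neighbourhood $V\subset U$ such that $p|_V$ is constant or $p|_V=f\circ q$ for some plot $q\colon V\to X$, $q\in D_X$. A map $f\colon (X,D_X)\to(Y,D_Y)$ is a subduction if $f$ is surjective and $f_\ast(D_X)=D_Y$. *)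

(* Defs.v *)
From HB Require Import structures.
From mathcomp Require Import all_boot all_order all_algebra.
From mathcomp Require Import ring.
From mathcomp Require Import all_classical all_reals all_analysis.
From mathcomp Require Import measurable_realfun.

Set Implicit Arguments.
Unset Strict Implicit.
Unset Printing Implicit Defensive.

Import Order.TTheory GRing.Theory Num.Theory.
Import numFieldNormedType.Exports.

Local Open Scope classical_set_scope.
Local Open Scope ring_scope.

Section classical_smoothness.
Context {R : realType}.

(* k times continuously Frechet differentiable on the open set U: as the source
   is finite dimensional, continuity of the derivative amounts to continuity of
   x |-> 'D_v f x for every direction v. *)
Fixpoint class_C {m : nat} {E : normedModType R} (k : nat)
    (U : set 'rV[R]_m) (f : 'rV[R]_m -> E) : Prop :=
  match k with
  | 0 => forall x, U x -> {for x, continuous f}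
  | k'.+1 => (forall x, U x -> differentiable f x) /\
             (forall v : 'rV[R]_m, class_C k' U (fun x => 'D_v f x))
  end.

(* As U is open, the values outside U of the extension f do not matter. *)
Definition smooth_on {m : nat} {E : normedModType R}
    (U : set 'rV[R]_m) (p : U -> E) : Prop :=
  exists f : 'rV[R]_m -> E,
    (forall x : U, p x = f (\val x)) /\ (forall k, class_C k U f).

End classical_smoothness.

Section parametrizations.
Variable R : realType.

Record parametrization (Y : Type) := Parametrization {
  pdim : nat;
  pdom : set 'rV[R]_pdim;
  pdom_open : open pdom;
  pfun :> pdom -> Y }.
Arguments pdom {Y} p _.
Arguments pdom_open {Y} p.
Arguments pfun {Y} p x.

Definition pcomp {X Y : Type} (f : X -> Y) (p : parametrization X) :
    parametrization Y :=
  Parametrization (pdom_open p) (fun x => f (p x)).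

Definition sub_incl {T : Type} {V U : set T} (VU : V `<=` U) (x : V) : U :=
  exist _ (\val x) (mem_set (VU _ (set_valP x))).

Definition prestrict {Y : Type} (p : parametrization Y) (V : set 'rV[R]_(pdim p))
    (oV : open V) (VU : V `<=` pdom p) : parametrization Y :=
  Parametrization oV (fun x => p (sub_incl VU x)).

Definition pprecomp {Y : Type} (p : parametrization Y) (m : nat)
    (O : set 'rV[R]_m) (oO : open O) (q : O -> pdom p) : parametrization Y :=
  Parametrization oO (fun x => p (q x)).

Definition pconst {Y : Type} (m : nat) (y : Y) : parametrization Y :=
  Parametrization (@openT 'rV[R]_m) (fun=> y).

Record is_diffeology {Y : Type} (D : set (parametrization Y)) : Prop := {
  diffeology_const : forall (m : nat) (y : Y), D (pconst m y);
  diffeology_local : forall p : parametrization Y,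
    (forall x : pdom p,
       exists (V : set 'rV[R]_(pdim p)) (oV : open V) (VU : V `<=` pdom p),
         V (\val x) /\ D (prestrict oV VU)) ->
    D p;
  diffeology_comp : forall (p : parametrization Y) (m : nat)
      (O : set 'rV[R]_m) (oO : open O) (q : O -> pdom p),
    D p -> smooth_on (fun x => \val (q x)) -> D (pprecomp oO q) }.

Definition smooth_map {X Y : Type} (DX : set (parametrization X))
    (DY : set (parametrization Y)) (f : X -> Y) : Prop :=
  forall p, DX p -> DY (pcomp f p).

(* The coarsest diffeology is the one with the most parametrizations, the
   finest the one with the fewest. *)
Definition is_pullback {X Y : Type} (f : X -> Y) (DY : set (parametrization Y))
    (D : set (parametrization X)) : Prop :=
  [/\ is_diffeology D, smooth_map D DY f &
      forall D', is_diffeology D' -> smooth_map D' DY f -> D' `<=` D].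

Definition is_pushforward {X Y : Type} (f : X -> Y)
    (DX : set (parametrization X)) (D : set (parametrization Y)) : Prop :=
  [/\ is_diffeology D, smooth_map DX D f &
      forall D', is_diffeology D' -> smooth_map DX D' f -> D `<=` D'].

Definition induction {X Y : Type} (DX : set (parametrization X))
    (DY : set (parametrization Y)) (f : X -> Y) : Prop :=
  injective f /\ is_pullback f DY DX.

Definition subduction {X Y : Type} (DX : set (parametrization X))
    (DY : set (parametrization Y)) (f : X -> Y) : Prop :=
  (forall y, exists x, f x = y) /\ is_pushforward f DX DY.

Definition classical_diffeology (E : normedModType R) :
    set (parametrization E) :=
  [set p | smooth_on (pfun p)].

End parametrizations.

Arguments classical_diffeology {R} E.

Section euclidean.
Variable R : realType.

(* The library norm on 'rV[R]_m is the sup norm. *)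
Definition enorm {m : nat} (x : 'rV[R]_m) : R :=
  Num.sqrt (\sum_(i < m) x 0 i ^+ 2).

Definition boundary {T : topologicalType} (X : set T) : set T :=
  closure X `\` X^°.

Definition compact_domain {d : nat} (X : set 'rV[R]_d) : Prop :=
  [/\ compact X, X !=set0, connected X^° & closure X^° = X].

(* The local coordinates at x are y = ([ytilde y], [ylast y]), where the point
   with coordinates y is x + y *m Q for an orthogonal matrix Q.  That x is a
   point of the graph of psi is expressed by psi 0 = 0. *)
Definition ytilde {n : nat} (y : 'rV[R]_n.+1) : 'rV[R]_n := col' ord_max y.
Definition ylast {n : nat} (y : 'rV[R]_n.+1) : R := y 0 ord_max.

Definition lipschitz_boundary {n : nat} (X : set 'rV[R]_n.+1) : Prop :=
  forall x, boundary X x ->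
    exists (Q : 'M[R]_n.+1) (a b L : R) (psi : 'rV[R]_n -> R),
      [/\ Q *m Q^T = 1%:M, 0 < a /\ 0 < b, psi 0 = 0,
          forall u v, enorm u < a -> enorm v < a ->
            `|psi u - psi v| <= L * enorm (u - v) &
          forall y : 'rV[R]_n.+1, enorm (ytilde y) < a ->
            [/\ ylast y = psi (ytilde y) -> boundary X (x + y *m Q),
                psi (ytilde y) < ylast y < psi (ytilde y) + b ->
                  X (x + y *m Q) &
                psi (ytilde y) - b < ylast y < psi (ytilde y) ->
                  ~ X (x + y *m Q)]].

Definition lipschitz_shape {n : nat} (G : set 'rV[R]_n.+1) : Prop :=
  exists X : set 'rV[R]_n.+1,
    [/\ compact_domain X, lipschitz_boundary X & G = boundary X].

End euclidean.

Section cover_outer_measure.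
Local Open Scope ereal_scope.
Context {R : realType} {T : Type} {I : pointedType}.
Variables (C : set I) (E : I -> set T) (g : I -> \bar R).

Definition cover_ext (A : set T) : \bar R :=
  ereal_inf [set \sum_(k <oo) g (F k) | F in
    [set F : nat -> I | (forall k, C (F k)) /\ A `<=` \bigcup_k E (F k)]].

Hypothesis g0 : forall i, 0 <= g i.
Hypothesis C0 : exists i, [/\ C i, g i = 0 & E i = set0].

Lemma cover_ext_ge0 A : 0 <= cover_ext A.
Proof.
apply: le_ereal_inf_tmp => x [B _ <-{x}]; rewrite lime_ge //=.
  exact: is_cvg_nneseries.
by near=> n; rewrite sume_ge0.
Unshelve. all: by end_near. Qed.

Lemma le_cover_ext : {homo cover_ext : A B / A `<=` B >-> A <= B}.
Proof.
move=> A B AB; apply/ereal_inf_le_tmp => x [B' [mB' BB']].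
by move=> <-{x}; exists B' => //; split => //; apply: subset_trans AB BB'.
Qed.

Lemma cover_ext0 : cover_ext set0 = 0.
Proof.
apply/eqP; rewrite eq_le; apply/andP; split; last exact/cover_ext_ge0.
have [i [Ci gi _]] := C0.
apply: ereal_inf_lbound; exists (fun=> i); first by split.
by apply: lim_near_cst => //; near=> n => /=; rewrite big1.
Unshelve. all: by end_near. Qed.

Lemma cover_ext_sigma_subadditive : sigma_subadditive cover_ext.
Proof.
move=> A; have [[i ioo]|] := pselect (exists i, cover_ext (A i) = +oo).
  rewrite (eseries_pinfty _ _ ioo) ?leey// => n _.
  by rewrite -ltNye (lt_le_trans _ (cover_ext_ge0 _)).
rewrite -forallNE => Aoo.
suff add2e (e : {posnum R}) :
    cover_ext (\bigcup_n A n) <= \sum_(i <oo) cover_ext (A i) + e%:num%:E.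
  by apply/lee_addgt0Pr => _/posnumP[].
rewrite (le_trans _ (epsilon_trick _ _ _))//; last first.
  by move=> n; exact: cover_ext_ge0.
pose P n (B : nat -> I) := ((forall k, C (B k)) /\ A n `<=` \bigcup_k E (B k))
  /\ \sum_(k <oo) g (B k) <= cover_ext (A n) + (e%:num / (2 ^ n.+1)%:R)%:E.
have [G PG] : {G : nat -> nat -> I & forall n, P n (G n)}.
  apply: (@choice _ _ P) => n; rewrite /P /cover_ext.
  set S := (X in ereal_inf X); move infS : (ereal_inf S) => iS.
  case: iS infS => [r Sr|Soo|Soo].
  - have en1 : (0 < e%:num / (2 ^ n.+1)%:R)%R by [].
    have /(lb_ereal_inf_adherent en1) : ereal_inf S \is a fin_num by rewrite Sr.
    move=> [x [B [mB AnB muBx] xS]].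
    by exists B; split => //; rewrite muBx -Sr; exact/ltW.
  - by have := Aoo n; rewrite /cover_ext Soo.
  - suff : lbound S 0 by move/le_ereal_inf_tmp; rewrite Soo.
    by move=> /= _ [B [mB AnB] <-]; exact: nneseries_ge0.
have muG_ge0 x : 0 <= (g \o uncurry G) x by exact: g0.
apply: (@le_trans _ _ (\esum_(i in setT) (g \o uncurry G) i)).
  rewrite /cover_ext; apply: ereal_inf_lbound => /=.
  have /card_esym/ppcard_eqP[f] := card_nat2.
  exists (uncurry G \o f).
    split => [i|]; first by rewrite /= /uncurry; case: (f i) => a b;
      exact: (PG a).1.1.
    apply: (@subset_trans _  (\bigcup_n \bigcup_k E (G n k))) => [t [i _]|].
      by move=> /(PG i).1.2 -[j _ ?]; exists i => //; exists j.
    move=> t [i _ [j _ Bijt]]; exists (f^-1%FUN (i, j)) => //=.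
    by rewrite invK ?inE.
  rewrite -(esum_pred_image (g \o uncurry G) _ xpredT) ?[fun=> _]set_true//.
  by rewrite image_eq.
rewrite (_ : esum _ _ = \sum_(i <oo) \sum_(j <oo ) g (G i j)); last first.
  pose J : nat -> set (nat * nat) := fun i => [set (i, j) | j in setT].
  rewrite (_ : setT = \bigcup_k J k); last first.
    by rewrite predeqE => -[a b]; split => // _; exists a => //; exists b.
  rewrite esum_bigcupT /=; last 2 first.
    - apply/trivIsetP => i j _ _ ij.
      rewrite predeqE => -[n m] /=; split => //= -[] [_] _ [<-{n} _].
      by move=> [m' _] [] /esym/eqP; rewrite (negbTE ij).
    - by move=> /= [n m]; exact: g0.
  rewrite -(image_id [set: nat]) -fun_true esum_pred_image//; last first.
    by move=> n _; exact: esum_ge0.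
  apply: eq_eseriesr => /= j _.
  rewrite -(esum_pred_image (g \o uncurry G) (pair j) predT)//=; last first.
    by move=> ? ? _ _; exact: (@can_inj _ _ _ snd).
  by congr esum; rewrite predeqE => -[a b]; split; move=> [i _ <-]; exists i.
apply: lee_lim.
- apply: is_cvg_nneseries => n *.
  by apply: nneseries_ge0 => m *; exact: (muG_ge0 (n, m)).
- by apply: is_cvg_nneseries => n *; apply: adde_ge0 => //; exact: cover_ext_ge0.
- by near=> n; apply: lee_sum => i _; exact: (PG i).2.
Unshelve. all: by end_near. Qed.

End cover_outer_measure.

Section hausdorff.
Local Open Scope ereal_scope.
Context {R : realType} {m : nat}.
Local Notation V := 'rV[R]_m.

Definition ediam (A : set V) : \bar R :=
  ereal_sup [set r | exists x y, [/\ A x, A y & r = (enorm (x - y))%:E]].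

(* The separate case gives the empty set the weight 0 also when s = 0. *)
Definition hausdorff_gauge (s : nat) (A : set V) : \bar R :=
  if A == set0 then 0 else ediam A `^ s%:R.

Definition hausdorff_pre (s : nat) (delta : R) (A : set V) : \bar R :=
  cover_ext [set U | ediam U <= delta%:E] id (hausdorff_gauge s) A.

(* The usual dimensional constant is left out: it only replaces the norm of
   H^{1/2} by an equivalent one. *)
Definition hausdorff (s : nat) (A : set V) : \bar R :=
  ereal_sup [set hausdorff_pre s delta A | delta in [set delta | (0 < delta)%R]].

Lemma hausdorff_gauge_ge0 s A : 0 <= hausdorff_gauge s A.
Proof. by rewrite /hausdorff_gauge; case: ifP => // _; exact: poweR_ge0. Qed.

Lemma hausdorff_gauge_set0 s (delta : R) :
  exists U : set V, [/\ [set U | ediam U <= delta%:E] U,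
    hausdorff_gauge s U = 0 & id U = set0].
Proof.
exists set0; split => //=; last by rewrite /hausdorff_gauge eqxx.
by apply: ge_ereal_sup => r [x [y [//]]].
Qed.

Lemma hausdorff_pre_ge0 s delta A : 0 <= hausdorff_pre s delta A.
Proof. by apply: cover_ext_ge0 => //; exact: hausdorff_gauge_ge0. Qed.

Lemma hausdorff_pre_le s delta A : (0 < delta)%R ->
  hausdorff_pre s delta A <= hausdorff s A.
Proof. by move=> d0; apply: ereal_sup_ubound; exists delta. Qed.

Lemma hausdorff_ge0 s A : 0 <= hausdorff s A.
Proof.
exact: le_trans (hausdorff_pre_ge0 s 1 A) (hausdorff_pre_le s A ltr01).
Qed.

Lemma hausdorff0 s : hausdorff s set0 = 0.
Proof.
apply/eqP; rewrite eq_le hausdorff_ge0 andbT.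
apply: ge_ereal_sup => _ [delta d0 <-].
rewrite /hausdorff_pre (cover_ext0 (hausdorff_gauge_ge0 s)) //.
exact: hausdorff_gauge_set0.
Qed.

Lemma le_hausdorff s : {homo hausdorff s : A B / A `<=` B >-> A <= B}.
Proof.
move=> A B AB; apply: ge_ereal_sup => _ [delta d0 <-].
apply: le_trans (hausdorff_pre_le s B d0).
exact: le_cover_ext.
Qed.

Lemma hausdorff_sigma_subadditive s : sigma_subadditive (hausdorff s).
Proof.
move=> A; apply: ge_ereal_sup => _ [delta d0 <-].
apply: (le_trans (cover_ext_sigma_subadditive
  [set U | ediam U <= delta%:E] id (hausdorff_gauge_ge0 s) A)).
apply: lee_nneseries => i *; first exact: hausdorff_pre_ge0.
exact: hausdorff_pre_le.
Qed.

(* Restricting to G makes the complement of G negligible, so that functions on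
   'rV[R]_m modulo almost everywhere equality are functions on G. *)
Definition surface (s : nat) (G A : set V) : \bar R := hausdorff s (A `&` G).

Lemma surface0 s G : surface s G set0 = 0.
Proof. by rewrite /surface set0I hausdorff0. Qed.

Lemma surface_ge0 s G A : 0 <= surface s G A.
Proof. exact: hausdorff_ge0. Qed.

Lemma le_surface s G : {homo surface s G : A B / A `<=` B >-> A <= B}.
Proof. by move=> A B AB; apply: le_hausdorff; exact: setSI. Qed.

Lemma surface_sigma_subadditive s G : sigma_subadditive (surface s G).
Proof.
by move=> A; rewrite /surface setI_bigcupl; exact: hausdorff_sigma_subadditive.
Qed.

HB.instance Definition _ (s : nat) (G : set V) :=
  isOuterMeasure.Build R V (surface s G) (surface0 s G) (surface_ge0 s G)
    (le_surface s G) (surface_sigma_subadditive s G).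

End hausdorff.

(* [\x] of the library asks for an s-finite measure, and the surface measure of
   an arbitrary set is not.  This is the product outer measure of Evans and
   Gariepy, which for sigma-finite measures extends the usual product. *)
Section outer_prod.
Local Open Scope ereal_scope.
Context {R : realType} {T : pointedType} (mu : {outer_measure set T -> \bar R}).

Definition outer_prod : set (T * T) -> \bar R :=
  cover_ext [set A : set T * set T | mu.-caratheodory A.1 /\
                                     mu.-caratheodory A.2]
    (fun A => A.1 `*` A.2) (fun A => mu A.1 * mu A.2).

Let g0 (A : set T * set T) : 0 <= mu A.1 * mu A.2.
Proof. by rewrite mule_ge0. Qed.

Let C0 : exists A : set T * set T,
  [/\ mu.-caratheodory A.1 /\ mu.-caratheodory A.2, mu A.1 * mu A.2 = 0 &
      A.1 `*` A.2 = set0].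
Proof.
exists (set0, set0); split => /=; last by rewrite set0X.
- by split; exact: caratheodory_measurable_set0.
- by rewrite outer_measure0 mul0e.
Qed.

HB.instance Definition _ :=
  isOuterMeasure.Build R (T * T)%type outer_prod
    (cover_ext0 g0 C0) (cover_ext_ge0 _ _ g0)
    (le_cover_ext _ _ _) (cover_ext_sigma_subadditive _ _ g0).

Lemma outer_prod_null (A B : set T) :
  mu.-caratheodory A -> mu.-caratheodory B -> mu A * mu B = 0 ->
  outer_prod (A `*` B) = 0.
Proof.
move=> mA mB AB0; apply/eqP; rewrite eq_le cover_ext_ge0// andbT.
apply: ereal_inf_lbound; exists (fun=> (A, B)).
  by split => // z ABz; exists 0%N.
by rewrite eseries0.
Qed.

End outer_prod.

Section l2_norm.
Variables (R : realType) (I : finType).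

Lemma sum_cauchy_schwarz (a b : I -> R) :
  (\sum_i a i * b i) ^+ 2 <= (\sum_i a i ^+ 2) * (\sum_i b i ^+ 2).
Proof.
have : 0 <= \sum_i \sum_j (a i * b j - a j * b i) ^+ 2.
  by apply: sumr_ge0 => i _; apply: sumr_ge0 => j _; exact: sqr_ge0.
suff -> : \sum_i \sum_j (a i * b j - a j * b i) ^+ 2 =
  ((\sum_i a i ^+ 2) * (\sum_i b i ^+ 2) - (\sum_i a i * b i) ^+ 2) *+ 2.
  by rewrite pmulrn_lge0// subr_ge0.
have E (u v : I -> R) : (\sum_i u i) * (\sum_i v i) =
    \sum_i \sum_j u i * v j.
  by rewrite mulr_suml; apply: eq_bigr => i _; rewrite mulr_sumr.
rewrite mulr2n [(\sum_i a i * b i) ^+ 2]expr2.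
rewrite [X in _ = _ + (X - _)]mulrC !E -!sumrB -big_split/=.
apply: eq_bigr => i _; rewrite -!sumrB -big_split/=.
by apply: eq_bigr => j _; ring.
Qed.

Lemma l2_triangle (a b : I -> R) :
  Num.sqrt (\sum_i (a i + b i) ^+ 2) <=
  Num.sqrt (\sum_i a i ^+ 2) + Num.sqrt (\sum_i b i ^+ 2).
Proof.
have s0 (u : I -> R) : 0 <= \sum_i u i ^+ 2.
  by apply: sumr_ge0 => i _; exact: sqr_ge0.
rewrite -[leRHS]ger0_norm ?addr_ge0 ?sqrtr_ge0// -sqrtr_sqr ler_wsqrtr//.
rewrite sqrrD !sqr_sqrtr//.
have -> : \sum_i (a i + b i) ^+ 2 =
    \sum_i a i ^+ 2 + (\sum_i a i * b i) *+ 2 + \sum_i b i ^+ 2.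
  by rewrite -sumrMnl -!big_split/=; apply: eq_bigr => i _; rewrite sqrrD.
rewrite lerD2r lerD2l lerMn2r/= -sqrtrM// (le_trans (ler_norm _))//.
by rewrite -sqrtr_sqr ler_wsqrtr// sum_cauchy_schwarz.
Qed.

End l2_norm.

Section Lnorm2.
Context {d : measure_display} {T : measurableType d} {R : realType}.
Variable mu : {measure set T -> \bar R}.
Let nm (f : T -> R) := fine 'N[mu]_2%:E[EFin \o f].

Lemma fine_Lnorm2D (f g : T -> R) :
  f \in Lfun mu 2%:E -> g \in Lfun mu 2%:E -> nm (f + g) <= nm f + nm g.
Proof.
move=> fL gL.
exact: (ler_LnormD (Lfun_Sub (lee1n 2) fL) (Lfun_Sub (lee1n 2) gL)).
Qed.

Lemma fine_Lnorm2Z a (f : T -> R) :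
  f \in Lfun mu 2%:E -> nm (a *: f) = `|a| * nm f.
Proof.
move=> fL; have := LnormZ (Lfun_Sub (lee1n 2) fL) a.
rewrite /nm /= => ->; rewrite fineM//.
by rewrite -(finite_norm_fine (Lfun_Sub (lee1n 2) fL)).
Qed.

Lemma fine_Lnorm2_ge0 (f : T -> R) : 0 <= nm f.
Proof. by rewrite fine_ge0// Lnorm_ge0. Qed.

Lemma fine_Lnorm2_eq0 (f : T -> R) :
  f \in Lfun mu 2%:E -> nm f = 0 -> f = cst 0 %[ae mu].
Proof.
move=> fL /(@fine_Lnormr_eq0 _ _ _ _ _ (lee1n 2) (Lfun_Sub (lee1n 2) fL)).
by [].
Qed.

Lemma fine_Lnorm2_ae0 (f : T -> R) :
  f \in Lfun mu 2%:E -> f = cst 0 %[ae mu] -> nm f = 0.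
Proof.
move=> fL f0; have /andP[/[!inE]/= mf _] := fL.
rewrite /nm unlock (_ : \int[mu]_x _ = 0)%E ?poweR0r//.
rewrite (ae_eq_integral (cst 0%E))//=; first exact: integral0.
- apply/measurable_EFinP; apply: (measurableT_comp (measurable_powR _)).
  exact: measurableT_comp.
- by apply: filterS f0 => x /(_ I) /= -> _; rewrite normr0 powR0.
Qed.
End Lnorm2.

Definition caratheodory_measure {R : realType} {T : pointedType}
    (mu : {outer_measure set T -> \bar R}) :
    {measure set (caratheodory_type mu) -> \bar R} :=
  (mu : set (caratheodory_type mu) -> \bar R).

Lemma caratheodory_null {R : realType} {T : pointedType}
    (mu : {outer_measure set T -> \bar R}) (A : set T) :
  mu A = 0%E -> mu.-caratheodory A.
Proof.
move=> A0; apply: le_caratheodory_measurable => X.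
have -> : mu (X `&` A) = 0%E.
  apply/eqP; rewrite eq_le outer_measure_ge0 andbT -A0.
  exact/le_outer_measure.
by rewrite add0e le_outer_measure.
Qed.

Section h12_functions.
Context {R : realType} {n : nat}.
Local Notation V := 'rV[R]_n.+1.
Variable G : set V.

Definition surface_measure := caratheodory_measure (surface n G).
Definition surface_measure2 := caratheodory_measure (outer_prod (surface n G)).

Definition coordf (i : 'I_n.+1) (w : V -> V) : V -> R := fun x => w x 0 i.

(* The square of this quotient is |f x - f y|^2 / |x - y|^(n + 2 s) with
   s = 1/2, n being the dimension of G. *)
Definition gagliardo (f : V -> R) : V * V -> R :=
  fun z => (f z.1 - f z.2) / enorm (z.1 - z.2) `^ (n.+1%:R / 2).

Definition h12 : {pred V -> V} :=
  [pred w : V -> V | [forall i,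
    (coordf i w \in Lfun surface_measure 2%:E) &&
    (gagliardo (coordf i w) \in Lfun surface_measure2 2%:E)]].

Definition l2norm (i : 'I_n.+1) (w : V -> V) : R :=
  fine 'N[surface_measure]_2%:E[EFin \o coordf i w].

Definition slobodeckij (i : 'I_n.+1) (w : V -> V) : R :=
  fine 'N[surface_measure2]_2%:E[EFin \o gagliardo (coordf i w)].

Definition h12_norm (w : V -> V) : R :=
  Num.sqrt (\sum_(i < n.+1) (l2norm i w ^+ 2 + slobodeckij i w ^+ 2)).
End h12_functions.

Section h12_theory.
Context {R : realType} {n : nat}.
Local Notation V := 'rV[R]_n.+1.
Variable G : set V.
Local Notation mu1 := (surface_measure G).
Local Notation mu2 := (surface_measure2 G).

Lemma coordfP i (a : R) (w v : V -> V) :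
  coordf i (a *: w + v) = a *: coordf i w + coordf i v.
Proof. by apply/funext => x; rewrite /coordf !fctE !mxE. Qed.

Lemma gagliardoP (a : R) (f g : V -> R) :
  gagliardo (a *: f + g) = a *: gagliardo f + gagliardo g.
Proof.
apply/funext => z; rewrite /gagliardo !fctE /GRing.scale/=.
by set k := (_ `^ _)^-1; ring.
Qed.

Lemma h12_submod_closed : submod_closed (h12 G).
Proof.
split.
  apply/forallP => i; apply/andP; split.
    rewrite (_ : coordf _ _ = 0); last by apply/funext => x; rewrite /coordf mxE.
    exact: (Lfun_submod_closed mu1 (lee1n 2)).1.
  rewrite (_ : gagliardo _ = 0).
    exact: (Lfun_submod_closed mu2 (lee1n 2)).1.
  apply/funext => x; rewrite /gagliardo /coordf !mxE subrr mul0r//.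
move=> a w v /forallP hw /forallP hv; apply/forallP => i.
have /andP[w1 w2] := hw i; have /andP[v1 v2] := hv i.
rewrite coordfP gagliardoP; apply/andP; split.
  exact: (Lfun_submod_closed mu1 (lee1n 2)).2.
exact: (Lfun_submod_closed mu2 (lee1n 2)).2.
Qed.
End h12_theory.
HB.instance Definition _ (R : realType) (n : nat) (G : set 'rV[R]_n.+1) :=
  GRing.isSubmodClosed.Build R ('rV[R]_n.+1 -> 'rV[R]_n.+1) (h12 G)
    (h12_submod_closed G).

Record h12_fun (R : realType) (n : nat) (G : set 'rV[R]_n.+1) := H12Fun {
  h12_val :> 'rV[R]_n.+1 -> 'rV[R]_n.+1;
  h12_valP : h12_val \in h12 G }.

Section h12_fun_structure.
Context {R : realType} {n : nat}.
Variable G : set 'rV[R]_n.+1.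
HB.instance Definition _ := [isSub for @h12_val R n G].
HB.instance Definition _ := [Choice of h12_fun G by <:].
HB.instance Definition _ := [SubChoice_isSubLmodule of h12_fun G by <:].

Definition h12_null : {pred h12_fun G} :=
  [pred w : h12_fun G | `[< (w : 'rV[R]_n.+1 -> 'rV[R]_n.+1) = cst 0
                  %[ae surface_measure G] >]].
Lemma h12_null_submod_closed : submod_closed h12_null.
Proof.
split; first by apply/asboolP; exact: aeW.
move=> a w v /asboolP w0 /asboolP v0; apply/asboolP.
have F := ae_filter_ringOfSetsType (surface_measure G).
apply: (@filterS2 _ _ F _ _ _ _ w0 v0) => x /(_ I) wx /(_ I) vx _.
have -> : h12_val (a *: w + v) x = a *: w x + v x by [].
by rewrite wx vx scaler0 addr0.
Qed.
HB.instance Definition _ := GRing.isSubmodClosed.Build R (h12_fun G) h12_null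
  h12_null_submod_closed.
End h12_fun_structure.
Arguments h12_null {R n} G _.

Definition H12 {R : realType} {n : nat} (G : set 'rV[R]_n.+1) : Type :=
  Quotient.quot (h12_null G).

Section h12_norm_theory.
Context {R : realType} {n : nat}.
Variable G : set 'rV[R]_n.+1.
Implicit Types w v : h12_fun G.

Lemma h12_normE w : h12_norm G w =
  Num.sqrt (\sum_(k : 'I_n.+1 + 'I_n.+1)
    (match k with inl i => l2norm G i w | inr i => slobodeckij G i w end) ^+ 2).
Proof. by rewrite /h12_norm big_split big_sumType. Qed.

Lemma h12_fun_Lfun w i :
  coordf i w \in Lfun (surface_measure G) 2%:E /\
  gagliardo (coordf i w) \in Lfun (surface_measure2 G) 2%:E.
Proof. by apply/andP; exact: (forallP (h12_valP w)). Qed.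

Let valP1 a w v : h12_val (a *: w + v) = a *: h12_val w + h12_val v.
Proof. by []. Qed.

Lemma h12_normD w v : h12_norm G (w + v) <= h12_norm G w + h12_norm G v.
Proof.
rewrite !h12_normE; apply: le_trans (l2_triangle _ _).
rewrite ler_wsqrtr// ler_sum// => k _.
rewrite ler_sqr ?nnegrE; last 2 first.
- by case: k => i; exact: fine_Lnorm2_ge0.
- by case: k => i; rewrite addr_ge0 ?fine_Lnorm2_ge0.
have -> : h12_val (w + v) = 1 *: h12_val w + h12_val v.
  by rewrite scale1r.
case: k => i; have [w1 w2] := h12_fun_Lfun w i;
  have [v1 v2] := h12_fun_Lfun v i.
- by rewrite /l2norm coordfP scale1r fine_Lnorm2D.
- by rewrite /slobodeckij coordfP gagliardoP scale1r fine_Lnorm2D.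
Qed.

Lemma h12_normZ a w : h12_norm G (a *: w) = `|a| * h12_norm G w.
Proof.
rewrite !h12_normE -sqrtr_sqr -sqrtrM ?sqr_ge0// mulr_sumr; congr Num.sqrt.
apply: eq_bigr => k _; rewrite -[a ^+ 2]real_normK ?num_real// -exprMn.
have -> : h12_val (a *: w) = a *: h12_val w by [].
congr (_ ^+ 2); case: k => i; have [w1 w2] := h12_fun_Lfun w i.
- rewrite /l2norm -fine_Lnorm2Z//; congr (fine (Lnorm _ _ (EFin \o _))).
  by apply/funext => x; rewrite /coordf !fctE mxE.
- rewrite /slobodeckij -fine_Lnorm2Z//.
  congr (fine (Lnorm _ _ (EFin \o _))).
  apply/funext => x; rewrite /gagliardo /coordf !fctE !mxE /GRing.scale/=.
  by rewrite mulrA mulrBr.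
Qed.

Lemma h12_norm_eq0 w : h12_norm G w = 0 -> w \in h12_null G.
Proof.
move=> /eqP; rewrite sqrtr_eq0 => w0.
have {}w0 i : l2norm G i w = 0.
  apply/eqP; rewrite -sqrf_eq0 eq_le sqr_ge0 andbT (le_trans _ w0)//.
  rewrite (bigD1 i)//= -addrA lerDl addr_ge0 ?sqr_ge0// sumr_ge0// => j _.
  by rewrite addr_ge0 ?sqr_ge0.
apply/asboolP.
have F := ae_filter_ringOfSetsType (surface_measure G).
have H : \forall x \ae surface_measure G, forall i, coordf i w x = 0.
  apply: (@filter_forall _ _ _ _ F) => i.
  have [wi _] := h12_fun_Lfun w i.
  have := fine_Lnorm2_eq0 wi (w0 i).
  by apply: (@filterS _ _ F) => x /(_ I).
apply: (@filterS _ _ F _ _ _ H) => x wx _.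
by apply/rowP => i; rewrite [LHS]wx mxE.
Qed.

Lemma h12_norm_null w : w \in h12_null G -> h12_norm G w = 0.
Proof.
move=> /asboolP w0.
have F := ae_filter_ringOfSetsType (surface_measure G).
have F2 := ae_filter_ringOfSetsType (surface_measure2 G).
rewrite /h12_norm big1 ?sqrtr0// => i _.
have [w1 w2] := h12_fun_Lfun w i.
rewrite /l2norm fine_Lnorm2_ae0//; last first.
  by apply: (@filterS _ _ F _ _ _ w0) => x /(_ I) wx _; rewrite /coordf wx mxE.
rewrite /slobodeckij fine_Lnorm2_ae0 ?expr0n ?addr0//.
move: w0 => [N [mN N0 wN]].
have mT : (surface n G).-caratheodory setT.
  rewrite -setC0; apply: caratheodory_measurable_setC.
  exact: caratheodory_measurable_set0.
have null : outer_prod (surface n G) (N `*` setT `|` setT `*` N) = 0.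
  apply/eqP; rewrite eq_le outer_measure_ge0 andbT.
  apply: le_trans (outer_measureU2 _ _ _) _.
  have N0' : surface n G N = 0%E := N0.
  have NT : (surface n G N * surface n G setT = 0)%E by rewrite N0' mul0e.
  have TN : (surface n G setT * surface n G N = 0)%E by rewrite N0' mule0.
  have /= -> := outer_prod_null (mu := surface n G) mN mT NT.
  have /= -> := outer_prod_null (mu := surface n G) mT mN TN.
  by rewrite adde0.
exists (N `*` setT `|` setT `*` N); split => //.
  exact: caratheodory_null.
move=> z /= /not_implyP[_]; apply: contra_notP => /not_orP[/= zN1 zN2].
have wz t : ~ N t -> w t = 0.
  by move=> Nt; apply: contra_notP Nt => wt; apply: wN => /= /(_ I).
have {}zN1 : ~ N z.1 by move=> ?; apply: zN1.
have {}zN2 : ~ N z.2 by move=> ?; apply: zN2.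
by rewrite /gagliardo /coordf !wz// mxE subrr mul0r.
Qed.
End h12_norm_theory.

Section H12_structure.
Context {R : realType} {n : nat}.
Variable G : set 'rV[R]_n.+1.
Local Open Scope quotient_scope.

HB.instance Definition _ := GRing.Zmodule.on (H12 G).
HB.instance Definition _ := EqQuotient.on (H12 G).

Definition H12_class (w : h12_fun G) : H12 G := \pi_(H12 G) w.

Definition H12_scale (a : R) (u : H12 G) : H12 G := H12_class (a *: repr u).
Definition H12_norm (u : H12 G) : R := h12_norm G (repr u).

Lemma H12_classP w v : H12_class w = H12_class v <-> w - v \in h12_null G.
Proof.
by rewrite Quotient.idealrBE; split => [wv|/eqP//]; apply/eqP; exact: wv.
Qed.

Lemma H12_class_repr u : H12_class (repr u) = u.
Proof. exact: reprK. Qed.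

Lemma H12_classD w v : H12_class (w + v) = H12_class w + H12_class v.
Proof. by rewrite /H12_class !piE. Qed.

Lemma repr_H12_class w : repr (H12_class w) - w \in h12_null G.
Proof. by apply/H12_classP; rewrite H12_class_repr. Qed.

Lemma H12_scale_class a w : H12_scale a (H12_class w) = H12_class (a *: w).
Proof.
by apply/H12_classP; rewrite -scalerBr rpredZ// repr_H12_class.
Qed.

Lemma H12_norm_class w : H12_norm (H12_class w) = h12_norm G w.
Proof.
have le w1 w2 : w1 - w2 \in h12_null G -> h12_norm G w1 <= h12_norm G w2.
  move=> /h12_norm_null w0; rewrite -[in leLHS](subrK w2 w1).
  by apply: le_trans (h12_normD _ _) _; rewrite w0 add0r.
apply/eqP; rewrite eq_le !le ?repr_H12_class//.
by rewrite -rpredN opprB repr_H12_class.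
Qed.

Let scaleA a b u : H12_scale a (H12_scale b u) = H12_scale (a * b) u.
Proof. by rewrite -(H12_class_repr u) !H12_scale_class scalerA. Qed.
Let scale1 : left_id 1 H12_scale.
Proof. by move=> u; rewrite -(H12_class_repr u) H12_scale_class scale1r. Qed.
Let scaleDr : right_distributive H12_scale +%R.
Proof.
move=> a u v; rewrite -(H12_class_repr u) -(H12_class_repr v) -H12_classD.
by rewrite !H12_scale_class scalerDr H12_classD.
Qed.
Let scaleDl u : {morph H12_scale^~ u : a b / a + b}.
Proof.
move=> a b; rewrite -(H12_class_repr u) !H12_scale_class scalerDl.
exact: H12_classD.
Qed.

HB.instance Definition _ :=
  GRing.Zmodule_isLmodule.Build R (H12 G) scaleA scale1 scaleDr scaleDl.

Let normD u v : H12_norm (u + v) <= H12_norm u + H12_norm v.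
Proof.
rewrite -(H12_class_repr u) -(H12_class_repr v) -H12_classD !H12_norm_class.
exact: h12_normD.
Qed.
Let normZ a u : H12_norm (a *: u) = `|a| * H12_norm u.
Proof.
by rewrite [a *: u]/(H12_scale a u) H12_norm_class h12_normZ.
Qed.
Let norm0 u : H12_norm u = 0 -> u = 0.
Proof.
move=> /h12_norm_eq0 u0.
rewrite -(H12_class_repr u) (_ : 0 = H12_class 0).
  by apply/H12_classP; rewrite subr0.
by rewrite /H12_class !piE.
Qed.

HB.instance Definition _ :=
  Lmodule_isNormed.Build R (H12 G) normD normZ norm0.

End H12_structure.

Section shapes.
Context {R : realType} {n : nat}.
Variable G : set 'rV[R]_n.+1.

(* An element of H^{1/2}, being a class of functions, is continuous when it has
   a continuous representative; this representative is unique on a Lipschitz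
   shape G, whose nonempty relatively open subsets have positive surface
   measure. *)
Definition cH12 : set (H12 G) :=
  [set u | exists w : h12_fun G,
     [/\ H12_class w = u, {within G, continuous w}, set_inj G w &
         lipschitz_shape (w @` G)]].

Definition crepr (u : cH12) : h12_fun G := projT1 (cid (set_valP u)).

Definition shape_of (u : cH12) : set 'rV[R]_n.+1 := crepr u @` G.

Definition same_shape (u v : cH12) : bool := `[< shape_of u = shape_of v >].

Lemma same_shape_equiv : equiv_class_of same_shape.
Proof.
split=> [u|u v|v u t]; first exact/asboolP.
  by apply/asboolP/asboolP.
by move=> /asboolP uv /asboolP vt; apply/asboolP; rewrite uv.
Qed.

Canonical same_shape_equivRel := EquivRelPack same_shape_equiv.

Definition cB12 : Type := {eq_quot same_shape}%qT.
HB.instance Definition _ := Choice.on cB12.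
HB.instance Definition _ := EqQuotient.on cB12.

Definition cH12_incl (u : cH12) : H12 G := \val u.

Definition shape_proj (u : cH12) : cB12 := (\pi_cB12 u)%qT.

End shapes.
Arguments cH12 {R n} G _.

(* Main.v *)
Require Import Defs.
From HB Require Import structures.
From mathcomp Require Import all_boot all_order all_algebra.
From mathcomp Require Import all_classical all_reals all_analysis.

Set Implicit Arguments.
Unset Strict Implicit.
Unset Printing Implicit Defensive.

Import Order.TTheory GRing.Theory Num.Theory.
Import numFieldNormedType.Exports.

Local Open Scope classical_set_scope.
Local Open Scope ring_scope.

(** Coarsest and finest diffeologies are unique as soon as they exist, since two
    of them contain each other; so the two diffeologies are determined one after
    the other, and only their existence needs an argument.

    The finest diffeology making a map smooth always exists: an intersection of
    diffeologies is a diffeology, because each axiom is inherited by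
    intersections.  The coarsest one cannot be had in the dual way, as a union of
    diffeologies need not be one.  Instead the parametrizations p whose composite with f is a
    plot form a diffeology, by the axioms of the target applied to these
    composites, and every diffeology making f smooth is contained in it
    ([is_pullback_preimage]).

    This requires that the classically smooth parametrizations of the normed
    space H^{1/2} form a diffeology ([classical_diffeologyP]), which is where the
    analysis lies.  Locality holds because differentiability and derivatives
    depend on germs only.  Stability under smooth reparametrization is the chain rule at
    every order, obtained by induction from the formula
    D_v (f o q) = sum_i (D_v q)_i (D_i f o q) ([derive_comp_rV]): its right-hand
    side only involves sums, products with scalar functions and a composition
    with one derivative less.

    Finally, the inclusion is injective and the projection surjective because
    they are a subtype inclusion and a quotient map. *)

(** * Differentiability in normed modules *)

Section differentiability.
Context {R : realType}.
Implicit Types V W E : normedModType R.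

(** The derivative of f at x is also a first-order expansion of g at x, as little
    o only sees germs, and uniqueness of the derivative turns this expansion
    into differentiability. *)
Lemma near_eq_differentiable V W (f g : V -> W) (x : V) :
  {near x, f =1 g} -> differentiable f x -> differentiable g x.
Proof.
move=> fg df.
have fgx : f x = g x by exact: (nbhs_singleton fg).
have gE : g \o shift x = cst (g x) + 'd f x +o_ (0 : V) id.
  have /eqaddoP fo := diff_locally df.
  apply/eqaddoP => e e0; have {}fo := fo e e0.
  have fgh : \forall h \near (0 : V), f (h + x) = g (h + x).
    by have := fg; rewrite [X in X -> _](near_shift 0) subr0.
  apply: filterS2 fgh fo => h fgh.
  by rewrite !fctE /= fgh fgx.
have E := diff_unique (diff_continuous df) gE.
by apply/diff_locallyP; rewrite E; split => //; exact: diff_continuous.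
Qed.

(** Makes the general derivative of continuous bilinear maps applicable to the
    product of a scalar function and a vector-valued one. *)
Lemma scaler_is_bilinear E :
  bilinear_for
    (GRing.Scale.Law.clone _ _ *:%R _) (GRing.Scale.Law.clone _ _ *:%R _)
    (@GRing.scale R E : R -> E -> E).
Proof.
split=> [u'|u] a x y /=.
- by rewrite scalerDl scalerA.
- by rewrite scalerDr !scalerA mulrC.
Qed.

HB.instance Definition _ E := bilinear_isBilinear.Build R R E E _ _
  (@GRing.scale R E : R -> E -> E) (@scaler_is_bilinear E).

Lemma is_diff_scale V E (a : V -> R) (f : V -> E) (x : V) :
  differentiable a x -> differentiable f x ->
  is_diff x (fun z => a z *: f z)
    (fun v => a x *: 'd f x v + 'd a x v *: f x).
Proof.
move=> da df.
pose scale : {bilinear R -> E -> E} := @GRing.scale R E.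
have c : continuous (fun p : R * E => p.1 *: p.2) by exact: scale_continuous.
have dp : differentiable (fun z => (a z, f z)) x by exact: differentiable_pair.
have db : differentiable (fun p : R * E => p.1 *: p.2) (a x, f x).
  exact: (differentiable_bilin (f := scale)).
apply: DiffDef; first exact: (differentiable_comp dp db).
rewrite (diff_comp dp db) (diff_bilin (f := scale))//.
by rewrite diff_pair.
Qed.

End differentiability.

(** * Functions of class C^k on an open set *)

Section class_C_theory.
Context {R : realType}.
Implicit Types (E : normedModType R) (m k : nat).

Lemma class_C_local m E k (U : set 'rV[R]_m) (f : 'rV[R]_m -> E) :
  (forall x, U x -> exists2 V : set 'rV[R]_m, V x & class_C k V f) ->
  class_C k U f.
Proof.
elim: k f => [f fU x /fU[V Vx]|k IH f fU]; first by move=> fV; exact: fV Vx.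
split=> [x /fU[V Vx [df _]]|v]; first exact: df.
by apply: IH => x /fU[V Vx [_ Df]]; exists V => //; exact: Df.
Qed.

(** Openness of U is what lets pointwise equality on U pass to derivatives at
    the points of U. *)
Lemma eq_class_C m E k (U : set 'rV[R]_m) (f g : 'rV[R]_m -> E) :
  open U -> (forall x, U x -> f x = g x) -> class_C k U f -> class_C k U g.
Proof.
move=> oU.
have near_U (h1 h2 : 'rV[R]_m -> E) x : (forall y, U y -> h1 y = h2 y) -> U x ->
    \near x, h1 x = h2 x.
  move=> h12 Ux; apply: filterS (open_nbhs_nbhs (conj oU Ux)) => y.
  exact: h12.
elim: k f g => [f g fg fU x Ux|k IH f g fg [df Df]].
  rewrite /prop_for /continuous_at -fg//.
  apply: cvg_trans (fU _ Ux); apply: (near_eq_cvg (F := nbhs x)).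
  exact: near_U.
split=> [x Ux|v].
  by apply: near_eq_differentiable (df _ Ux); exact: near_U.
apply: IH (Df v) => x Ux; apply: near_eq_derive; exact: near_U.
Qed.

Lemma class_CW m E k (U : set 'rV[R]_m) (f : 'rV[R]_m -> E) :
  class_C k.+1 U f -> class_C k U f.
Proof.
elim: k f => [f [df _] x Ux|k IH f [df Df]].
  exact/differentiable_continuous/df.
by split=> // v; exact: IH (Df v).
Qed.

Lemma class_C_cst m E k (U : set 'rV[R]_m) (a : E) : class_C k U (fun=> a).
Proof.
elim: k a => [|k IH] a; first by move=> x _; exact: cst_continuous.
split=> [x _|v]; first exact: differentiable_cst.
rewrite (_ : 'D_v _ = fun=> 0); first exact: IH.
by apply/funext => x; exact: derive_cst.
Qed.

Lemma class_CD m E k (U : set 'rV[R]_m) (f g : 'rV[R]_m -> E) :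
  open U -> class_C k U f -> class_C k U g -> class_C k U (f + g).
Proof.
move=> oU; elim: k f g => [f g fU gU x Ux|k IH f g [df Df] [dg Dg]].
  exact: continuousD (fU _ Ux) (gU _ Ux).
split=> [x Ux|v]; first exact: differentiableD (df _ Ux) (dg _ Ux).
apply: eq_class_C (IH _ _ (Df v) (Dg v)) => // x Ux; rewrite deriveD//.
  exact/diff_derivable/df.
exact/diff_derivable/dg.
Qed.

Lemma class_C_sum m E k (U : set 'rV[R]_m) (I : finType)
    (f : I -> 'rV[R]_m -> E) :
  open U -> (forall i, class_C k U (f i)) -> class_C k U (\sum_i f i).
Proof.
move=> oU fU; apply: (big_ind (class_C k U)) => //; first exact: class_C_cst.
by move=> g h; exact: class_CD.
Qed.

(** Induction with the Leibniz rule, each term of which has lost one derivative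
    in one factor only; hence the need for [class_CW] on the other. *)
Lemma class_C_scale m E k (U : set 'rV[R]_m) (a : 'rV[R]_m -> R)
    (f : 'rV[R]_m -> E) :
  open U -> class_C k U a -> class_C k U f ->
  class_C k U (fun x => a x *: f x).
Proof.
move=> oU; elim: k a f => [a f aU fU x Ux|k IH a f aU fU].
  exact: cvgZ (aU _ Ux) (fU _ Ux).
have [[da Da] [df Df]] := (aU, fU).
split=> [x Ux|v]; first by have [] := is_diff_scale (da _ Ux) (df _ Ux).
apply: (@eq_class_C _ _ _ _
  ((fun x => a x *: 'D_v f x) + (fun x => 'D_v a x *: f x))) => //.
  move=> x Ux; have [d Ed] := is_diff_scale (da _ Ux) (df _ Ux).
  by rewrite (deriveE _ d) Ed !fctE (deriveE _ (da _ Ux)) (deriveE _ (df _ Ux)).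
by apply: class_CD => //; apply: IH;
  [exact: class_CW|exact: Df|exact: Da|exact: class_CW].
Qed.

Lemma class_C_coord m l k (U : set 'rV[R]_m) (q : 'rV[R]_m -> 'rV[R]_l)
    (i : 'I_l) :
  open U -> class_C k U q -> class_C k U (fun x => q x 0 i).
Proof.
move=> oU; elim: k q => [q qU x Ux|k IH q [dq Dq]].
  exact: (continuous_comp (qU _ Ux) (@coord_continuous R 1 l 0 i (q x))).
have coordE x : differentiable q x ->
    is_diff x (fun x => q x 0 i : R) (fun v => 'd q x v 0 i).
  move=> dqx; have lin : linear (fun y : 'rV[R]_l => y 0 i : R^o).
    by move=> a y z; rewrite !mxE.
  pose linM := GRing.isLinear.Build _ _ _ _ _ lin.
  pose L : {linear 'rV[R]_l -> R^o} := HB.pack (fun y : 'rV[R]_l => y 0 i) linM.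
  have cL : continuous L by exact: coord_continuous.
  have dL : differentiable L (q x) by exact: linear_differentiable.
  apply: DiffDef; first exact: (differentiable_comp dqx dL).
  by rewrite (diff_comp dqx dL) (diff_lin _ cL).
split=> [x Ux|v]; first by have [] := coordE _ (dq _ Ux).
apply: eq_class_C (IH _ (Dq v)) => // x Ux; have [d Ed] := coordE _ (dq _ Ux).
by rewrite (deriveE _ d) Ed (deriveE _ (dq _ Ux)).
Qed.

(** Expanding the direction in the canonical basis replaces the composite of two
    differentials by products of functions, so that the classes C^k of the
    factors determine that of the result. *)
Lemma derive_comp_rV m l E (q : 'rV[R]_m -> 'rV[R]_l) (f : 'rV[R]_l -> E) x v :
  differentiable q x -> differentiable f (q x) ->
  'D_v (f \o q) x =
  \sum_(i < l) 'D_v q x 0 i *: 'D_(delta_mx 0 i) f (q x).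
Proof.
move=> dq df; have dfq := differentiable_comp dq df.
rewrite (deriveE _ dfq) (diff_comp dq df) /= (deriveE _ dq).
rewrite [X in 'd f _ X]row_sum_delta linear_sum; apply: eq_bigr => i _.
by rewrite linearZ (deriveE _ df).
Qed.

Lemma class_C_comp m l E k (O : set 'rV[R]_m) (U : set 'rV[R]_l)
    (q : 'rV[R]_m -> 'rV[R]_l) (f : 'rV[R]_l -> E) :
  open O -> (forall x, O x -> U (q x)) ->
  class_C k O q -> class_C k U f -> class_C k O (f \o q).
Proof.
move=> oO qU; elim: k f => [f qO fU x Ox|k IH f qO [df Df]].
  exact: continuous_comp (qO _ Ox) (fU _ (qU _ Ox)).
have [dq Dq] := qO.
split=> [x Ox|v]; first exact: differentiable_comp (dq _ Ox) (df _ (qU _ Ox)).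
apply: (@eq_class_C _ _ _ _
  (\sum_(i < l) fun x => 'D_v q x 0 i *: ('D_(delta_mx 0 i) f \o q) x)) => //.
  move=> x Ox; rewrite derive_comp_rV; [|exact: dq|exact/df/qU].
  by rewrite fct_sumE.
apply: class_C_sum => // i; apply: class_C_scale => //.
  exact: (class_C_coord (q := 'D_v q)) (Dq v).
by apply: IH; [exact: class_CW|exact: Df].
Qed.

End class_C_theory.

(** * Classically smooth parametrizations *)

Section classical_diffeology_theory.
Context {R : realType} (E : normedModType R).

(** Smoothness on an open domain does not depend on the values of the extension
    outside of it, so extending by 0 glues the local extensions into one that is
    smooth near every point of the domain. *)
Lemma classical_diffeologyP : is_diffeology (classical_diffeology E).
Proof.
split=> [m y|p p_local|p m O oO q [f [pf fU]] [g [qg gO]]].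
- by exists (fun=> y); split => // k; exact: class_C_cst.
- pose f (y : 'rV[R]_(pdim p)) : E :=
    if pselect (@pdom _ _ p y) is left Uy then p (SigSub (mem_set Uy)) else 0.
  have fE (x : @pdom _ _ p) : p x = f (\val x).
    rewrite /f; case: pselect => [Ux|]; last by case; exact: set_valP.
    by congr (p _); apply: val_inj.
  exists f; split => // k.
  apply: class_C_local => x Ux.
  have [V [oV [VU [/= Vx [g [pg gV]]]]]] := p_local (SigSub (mem_set Ux)).
  exists V => //; apply: eq_class_C (gV k) => // y Vy.
  have := pg (SigSub (mem_set Vy)); rewrite /= => <-.
  by rewrite fE.
exists (f \o g); split=> [x|k]; first by rewrite /= pf qg.
apply: class_C_comp (gO k) (fU k) => // x Ox.
by have := qg (SigSub (mem_set Ox)) => /= <-; exact: set_valP.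
Qed.

End classical_diffeology_theory.

(** * Pullback and pushforward diffeologies *)

Section universal_constructions.
Context {R : realType} {X Y : Type}.
Implicit Types (DX : set (parametrization R X)) (DY : set (parametrization R Y)).

Lemma is_pullback_preimage (f : X -> Y) DY :
  is_diffeology DY -> is_pullback f DY (@Defs.pcomp R X Y f @^-1` DY).
Proof.
move=> dY; split=> [|p //|D' _ fs p D'p]; last exact: fs.
split=> [m y|p p_local|p m O oO q Dp q_smooth].
- exact: (diffeology_const dY m (f y)).
- exact: (diffeology_local dY (p := Defs.pcomp f p)).
- exact: (@diffeology_comp _ _ _ dY (Defs.pcomp f p) m O oO q).
Qed.

Lemma is_pushforward_bigcap (f : X -> Y) DX :
  is_pushforward f DX
    (\bigcap_(D in [set D | is_diffeology D /\ smooth_map DX D f]) D).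
Proof.
split=> [|p DXp D [_]|D' dD' fs p]; [|exact|exact].
split=> [m y D [dD _]|p p_local D [dD fs]|p m O oO q Dp q_smooth D [dD fs]].
- exact: diffeology_const.
- apply: diffeology_local => // x; have [V [oV [VU [Vx Dp]]]] := p_local x.
  by exists V, oV, VU; split => //; exact: Dp.
- by apply: diffeology_comp => //; exact: Dp.
Qed.

Lemma is_pullback_unique (f : X -> Y) DY D1 D2 :
  is_pullback f DY D1 -> is_pullback f DY D2 -> D1 = D2.
Proof. by move=> [d1 s1 m1] [d2 s2 m2]; apply/seteqP; split; auto. Qed.

Lemma is_pushforward_unique (f : X -> Y) DX D1 D2 :
  is_pushforward f DX D1 -> is_pushforward f DX D2 -> D1 = D2.
Proof. by move=> [d1 s1 m1] [d2 s2 m2]; apply/seteqP; split; auto. Qed.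

End universal_constructions.

Theorem theorem3p18 (R : realType) (n : nat) (G0 : set 'rV[R]_n.+1)
    (hG0 : lipschitz_shape G0) :
  exists! D : set (parametrization R (cH12 G0)) *
              set (parametrization R (cB12 G0)),
    [/\ is_diffeology D.1,
        is_diffeology D.2,
        induction D.1 (classical_diffeology (H12 G0)) (@cH12_incl R n G0) &
        subduction D.1 D.2 (@shape_proj R n G0)].
Proof.
have pb := is_pullback_preimage (@cH12_incl R n G0)
  (classical_diffeologyP (H12 G0)).
set DH := (X in is_pullback _ _ X) in pb.
have pf := is_pushforward_bigcap (@shape_proj R n G0) DH.
set DB := (X in is_pushforward _ _ X) in pf.
exists (DH, DB); split=> [|[D1 D2] /= [_ _ [_ pb1] [_ pf2]]].
  split=> /=; [by case: pb|by case: pf|split=> //; exact: val_inj|split=> //].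
  by move=> y; exists (repr y)%qT; exact: reprK.
have E1 := is_pullback_unique pb pb1.
by rewrite -E1 in pf2 *; rewrite (is_pushforward_unique pf pf2).
Qed.
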